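(* Let $n$ be a positive integer, let $a,t\in\mathbb{R}$, and put $\lambda_*=a-t$ and $\lambda_{**}=a-t+nt$. Let $f$ be an analytic function such that $f(\lambda_{**})$ and $f(\lambda_* )$ are well-defined. Then $f(\mathbf{M}(a,t))=\mathbf{M}(\tilde{a},\tilde{t})$, where $$\tilde{a}\equiv\frac{f(\lambda_{**})+(n-1)f(\lambda_* )}{n}=\frac{f(a-t+nt)+(n-1)f(a-t)}{n},$$ $$\tilde{t}\equiv\frac{f(\lambda_{**})-f(\lambda_* )}{n}=\frac{f(a-t+nt)-f(a-t)}{n}.$$ Explicitly, $$f(\mathbf{M}(a,t))=f(a-t)\cdot\mathbf{I}_{n\times n}+\frac{f(a-t+nt)-f(a-t)}{n}\cdot\mathbf{1}_{n\times n}.$$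
   Context: $\mathbf{M}(a,t)=(a-t)\cdot\mathbf{I}_{n\times n}+t\cdot\mathbf{1}_{n\times n}$ is the $n\times n$ double-constant matrix, with every diagonal entry equal to $a$ and every off-diagonal entry equal to $t$; the same formula is used if the two constants are complex. Here $\mathbf{I}_{n\times n}$ is the identity matrix and $\mathbf{1}_{n\times n}$ is the matrix all of whose entries equal $1$. The matrix $\mathbf{M}(a,t)$ is real symmetric, hence diagonalizable, and its eigenvalues are among $\lambda_*$ and $\lambda_{**}$. The function $f$ is analytic on an open set (in $\mathbb{C}$) containing $\lambda_*$ and $\lambda_{**}$, and applying $f$ to a matrix is meant in the usual sense of matrix functions (Sylvester's formula): if $A=P\,\mathrm{diag}(\mu_1,\ldots,\mu_n)P^{-1}$ then $f(A)=P\,\mathrm{diag}(f(\mu_1),\ldots,f(\mu_n))P^{-1}$, which does not depend on the choice of diagonalization. *)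

(* Defs.v *)
(* MathComp / MathComp-Analysis *)
From mathcomp Require Import all_boot all_order all_algebra.
From mathcomp Require Export complex.
From mathcomp Require Import all_classical all_reals all_analysis.

Set Implicit Arguments.
Unset Strict Implicit.
Unset Printing Implicit Defensive.

Import Order.TTheory GRing.Theory Num.Theory.
Import numFieldNormedType.Exports.

Local Open Scope classical_set_scope.
Local Open Scope ring_scope.

Definition dcmx (K : pzRingType) (n : nat) (a t : K) : 'M[K]_n :=
  (a - t)%:M + t *: const_mx 1.

Lemma dcmxE (K : pzRingType) n (a t : K) (i j : 'I_n) :
  dcmx n a t i j = if i == j then a else t.
Proof.
rewrite !mxE mulr1; case: eqP => _; first by rewrite mulr1n subrK.
by rewrite mulr0n add0r.
Qed.

(* For K = R[i], openness and convergence refer to the metric given by the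
   complex modulus. The power series centred at z0 converges to f on a whole
   neighbourhood of z0. Values of f outside U are irrelevant. *)
Definition analytic_on (K : numFieldType) (U : set K) (f : K -> K) : Prop :=
  open U /\
  forall z0, U z0 -> exists c : nat -> K,
    \forall z \near z0, [series c k * (z - z0) ^+ k]_k @ \oo --> f z.

Definition is_mxfun (K : fieldType) (n : nat) (f : K -> K) (A B : 'M[K]_n) :=
  exists P : 'M[K]_n, exists mu : 'rV[K]_n,
    [/\ P \in unitmx,
        A = P *m diag_mx mu *m invmx P
      & B = P *m diag_mx (map_mx f mu) *m invmx P].

(* f(A); by mxfunE below this is the value computed from any diagonalization
   of A. It is the junk value 0 when A is not diagonalizable. *)
Definition mxfun (K : fieldType) (n : nat) (f : K -> K) (A : 'M[K]_n) :
    'M[K]_n :=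
  xget 0 [set B | is_mxfun f A B].

Lemma is_mxfun_uniq (K : fieldType) n (f : K -> K) (A B C : 'M[K]_n) :
  is_mxfun f A B -> is_mxfun f A C -> B = C.
Proof.
move=> [P [mu [Pu AP ->]]] [Q [nu [Qu AQ ->]]].
pose W := invmx Q *m P.
have QW : Q *m W = P by rewrite mulmxA mulmxV // mul1mx.
have WP : W *m invmx P = invmx Q by rewrite -mulmxA mulmxV // mulmx1.
have W_int : W *m diag_mx mu = diag_mx nu *m W.
  rewrite /W -mulmxA -[P *m _](mulmxKV Pu) -AP AQ.
  by rewrite -!mulmxA mulKmx.
clearbody W.
have Wf : W *m diag_mx (map_mx f mu) = diag_mx (map_mx f nu) *m W.
  apply/matrixP=> i j; move/matrixP/(_ i j): W_int.
  rewrite !mul_mx_diag !mul_diag_mx !mxE [LHS]mulrC => Wij.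
  have [->|W0] := eqVneq (W i j) 0; first by rewrite mul0r mulr0.
  by rewrite [LHS]mulrC (mulIf W0 Wij).
by rewrite -{1}QW -(mulmxA Q) Wf -!mulmxA WP.
Qed.

Lemma mxfunE (K : fieldType) n (f : K -> K) (P : 'M[K]_n) (mu : 'rV[K]_n) :
  P \in unitmx ->
  mxfun f (P *m diag_mx mu *m invmx P)
    = P *m diag_mx (map_mx f mu) *m invmx P.
Proof.
move=> Pu.
have fP : is_mxfun f (P *m diag_mx mu *m invmx P)
                     (P *m diag_mx (map_mx f mu) *m invmx P).
  by exists P, mu.
apply: is_mxfun_uniq (fP).
by rewrite /mxfun; case: xgetP => [B _ //|/(_ _ fP)].
Qed.

(* Main.v *)
(* The all-ones matrix J satisfies J = P (n E_00) P^-1, where the first column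
   of P is (1, ..., 1) and its other columns are e_j - e_0. Hence P
   diagonalizes every M(a, t) = (a - t) I + t J, with eigenvalue a - t + nt
   on the first column and a - t on the others, and conjugating the values of
   f back by P is again of the form y I + (x - y) / n J. *)
Require Import Defs.
From mathcomp Require Import all_boot all_order all_algebra.
From mathcomp Require Import ring.
From mathcomp Require Import all_classical all_reals all_analysis.

Import GRing.Theory Num.Theory.

Local Open Scope ring_scope.
Local Open Scope complex_scope.

(** Divided by its order, the all-ones matrix is the projection onto the line of constant vectors
    along the vectors of coordinate sum zero, hence similar to [delta_mx 0 0]. *)
Lemma const_mx1_diagonalization (K : fieldType) (m : nat) :
  m.+1%:R != 0 :> K ->
  exists2 P : 'M[K]_m.+1, P \in unitmx &
    P *m delta_mx 0 0 *m invmx P = m.+1%:R^-1 *: const_mx 1.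
Proof.
move=> n0.
pose P : 'M[K]_m.+1 :=
  \matrix_(i, j) if j == 0 then 1 else (i == j)%:R - (i == 0)%:R.
(* The inverse of [P]: it sends a vector to its mean (coordinate 0) and to the deviations of its
   other coordinates from that mean. *)
pose Q : 'M[K]_m.+1 :=
  \matrix_(i, j) if i == 0 then m.+1%:R^-1 else (i == j)%:R - m.+1%:R^-1.
have sum_eq (k : 'I_m.+1) (F : 'I_m.+1 -> K) :
    \sum_i (i == k)%:R * F i = F k.
  rewrite (bigD1 k) //= eqxx mul1r big1 ?addr0 // => i /negPf ->.
  by rewrite mul0r.
(* Each row of [Q] is constant up to a unit vector, so [Q *m P] reduces to column sums and single
   entries of [P]. *)
have colsumP j : \sum_i P i j = m.+1%:R * (j == 0)%:R.
  have [->|j0] := eqVneq j 0.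
    under eq_bigr do rewrite mxE eqxx.
    by rewrite sumr_const card_ord mulr1.
  under eq_bigr do rewrite mxE (negPf j0) -[_%:R]mulr1 -[(_ == 0)%:R]mulr1.
  by rewrite sumrB !(sum_eq _ (fun=> 1)) subrr mulr0.
have QP : Q *m P = 1%:M.
  apply/matrixP => i j; rewrite mxE [RHS]mxE.
  have VcolsumP : m.+1%:R^-1 * (\sum_k P k j) = (j == 0)%:R.
    by rewrite colsumP mulKf.
  have [->|i0] := eqVneq i 0.
    under eq_bigr do rewrite [Q _ _]mxE eqxx.
    by rewrite -mulr_sumr VcolsumP eq_sym.
  under eq_bigr do rewrite [Q _ _]mxE (negPf i0) mulrBl [i == _]eq_sym.
  rewrite sumrB sum_eq -mulr_sumr VcolsumP mxE (negPf i0) subr0.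
  by case: eqVneq => [->|_]; rewrite ?(negPf i0) subrr || rewrite subr0.
have [_ Pu] := mulmx1_unit QP.
exists P => //.
have <- : Q = invmx P by rewrite -[Q]mulmx1 -(mulmxV Pu) mulmxA QP mul1mx.
(* Splitting [delta_mx 0 0] into a column times a row leaves the first column of [P] (all 1) times
   the first row of [Q] (all [m.+1%:R^-1]). *)
rewrite -(mul_delta_mx (0 : 'I_1)) mulmxA -colE -mulmxA -rowE.
by apply/matrixP => i j; rewrite !mxE big_ord1 !mxE eqxx mul1r mulr1.
Qed.

Lemma mxfun_dcmx (K : fieldType) (n : nat) (f : K -> K) (a t : K) :
  n%:R != 0 :> K ->
  mxfun f (dcmx n a t) =
    (f (a - t))%:M
    + ((f (a - t + n%:R * t) - f (a - t)) / n%:R) *: const_mx 1.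
Proof.
case: n => [|m] n0; first by rewrite eqxx in n0.
have [P Pu PE] := const_mx1_diagonalization _ _ n0.
pose mu x y : 'rV[K]_m.+1 := \row_j if j == 0 then x else y.
(* Kept general in [x] and [y] to serve twice: for the eigenvalues, then for their images under
   [f]. *)
have conjE x y : P *m diag_mx (mu x y) *m invmx P
    = y%:M + ((x - y) / m.+1%:R) *: const_mx 1.
  have -> : diag_mx (mu x y) = y%:M + (x - y) *: delta_mx 0 0.
    apply/matrixP => i j; rewrite !mxE.
    have [<-|ij] := eqVneq i j; last first.
      case: (eqVneq i 0) ij => [->|_ _]; last by rewrite mulr0 addr0.
      by rewrite eq_sym => /negPf ->; rewrite mulr0 addr0.
    by case: eqP => _; rewrite ?mulr1 ?mulr0 ?addr0 // addrC subrK.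
  rewrite mulmxDr mulmxDl -scalemxAr -scalemxAl PE scalerA.
  by rewrite mul_mx_scalar -scalemxAl mulmxV // scalemx1.
have -> : dcmx m.+1 a t
    = P *m diag_mx (mu (a - t + m.+1%:R * t) (a - t)) *m invmx P.
  by rewrite conjE addrAC subrr add0r mulrAC mulfV // mul1r.
rewrite mxfunE // -conjE; congr (_ *m diag_mx _ *m _).
by apply/rowP => j; rewrite !mxE; case: ifP.
Qed.

Theorem theorem6 (R : realType) (n : nat) (a t : R)
    (U : set R[i]) (f : R[i] -> R[i]) :
  (0 < n)%N ->
  let lam1 : R := a - t in
  let lam2 : R := a - t + n%:R * t in
  analytic_on U f -> U lam1%:C -> U lam2%:C ->
  let M : 'M[R[i]]_n := map_mx (real_complex R) (dcmx n a t) in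
  let a' : R[i] := (f lam2%:C + (n%:R - 1) * f lam1%:C) / n%:R in
  let t' : R[i] := (f lam2%:C - f lam1%:C) / n%:R in
  mxfun f M = dcmx n a' t' /\
  mxfun f M =
    (f (a - t)%:C)%:M
    + ((f (a - t + n%:R * t)%:C - f (a - t)%:C) / n%:R) *: const_mx 1.
Proof.
move=> n_gt0 lam1 lam2 _ _ _ M a' t'.
have n0 : n%:R != 0 :> R[i] by rewrite pnatr_eq0 -lt0n.
have ME : M = dcmx n a%:C t%:C.
  by apply/matrixP => i j; rewrite mxE !dcmxE; case: eqP.
have fM : mxfun f M = (f lam1%:C)%:M
    + ((f lam2%:C - f lam1%:C) / n%:R) *: const_mx 1.
  rewrite ME mxfun_dcmx // /lam2 /lam1.
  by rewrite !rmorphD rmorphN rmorphM rmorph_nat.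
split=> //; rewrite fM /dcmx -/t'; congr (_%:M + _).
(* What remains is the coefficient of the identity: [f lam1%:C = a' - t']. *)
by rewrite /a' /t'; field.
Qed.
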